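(* For each real $\epsilon > 0$, there is $\Delta_0 \in \mathbb{N}$ such that the following holds. Let $\Delta \geq \Delta_0$ be an integer and let $G$ be a triangle-free graph of maximum degree at most $\Delta$. Then, for all integers $q \geq (1+\epsilon)\Delta/\log\Delta$ and every $q$-fold DP-cover $\mathcal{H}$ of $G$, the number of proper $\mathcal{H}$-colorings of $G$ is at least $$\left(1-\frac{1}{q}\right)^m \bigl((1-\delta)q\bigr)^n,$$ where $n = |V(G)|$, $m = |E(G)|$, and $\delta = 4\exp(\Delta/q)/q$.
   Context: All graphs are finite, undirected, and simple; $\log$ is the natural logarithm. A DP-cover of a graph $G$ is a pair $\mathcal{H} = (L,H)$, where $H$ is a graph and $L$ assigns to each $v \in V(G)$ a subset $L(v) \subseteq V(H)$ such that: (i) the family $(L(v) : v \in V(G))$ is a partition of $V(H)$; (ii) for each $v \in V(G)$, $L(v)$ is an independent set in $H$; (iii) for distinct $u,v \in V(G)$, the edges of $H$ between $L(u)$ and $L(v)$ form a (not necessarily perfect) matching, which is empty whenever $uv \notin E(G)$. The DP-cover is $q$-fold if $|L(v)| = q$ for all $v \in V(G)$. An $\mathcal{H}$-coloring is a map $f \colon V(G) \to V(H)$ with $f(v) \in L(v)$ for all $v \in V(G)$. It is proper if the image of $f$ is an independent set in $H$, i.e., $f(u)$ and $f(v)$ are not adjacent in $H$ for all $u,v \in V(G)$. *)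

(* Defs.v *)
From mathcomp Require Import all_boot.

Set Implicit Arguments.
Unset Strict Implicit.
Unset Printing Implicit Defensive.

Record sgraph := SGraph {
  vertex :> finType;
  adj : rel vertex;
  adj_sym : symmetric adj;
  adj_irrefl : irreflexive adj }.

Definition edges_between (G : sgraph) (A B : {set G}) : {set {set G}} :=
  [set [set x; y] | x in A, y in B & adj x y].

Definition edges (G : sgraph) : {set {set G}} := edges_between [set: G] [set: G].

Definition degree (G : sgraph) (x : G) : nat := #|[set y | adj x y]|.

Definition max_degree (G : sgraph) : nat := \max_(x : G) degree x.

Definition triangle_free (G : sgraph) : Prop :=
  forall x y z : G, ~ [/\ adj x y, adj y z & adj x z].

Definition independent (G : sgraph) (A : {set G}) : bool :=
  [forall x in A, forall y in A, ~~ adj x y].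

(* The lists are a partition of the cover graph as an indexed family.         *)
(* [trivIset] of a set of edges says that distinct edges are disjoint, which  *)
(* is the definition of a matching.                                           *)
Record dp_cover (G : sgraph) := DPCover {
  cover_graph : sgraph;
  cover_list : G -> {set cover_graph};
  cover_list_disjoint :
    forall u v : G, u != v -> [disjoint cover_list u & cover_list v];
  cover_list_cover : \bigcup_(v : G) cover_list v = [set: cover_graph];
  cover_list_independent : forall v : G, independent (cover_list v);
  cover_matching : forall u v : G, u != v ->
    trivIset (edges_between (cover_list u) (cover_list v));
  cover_nonedge : forall u v : G, u != v -> ~~ adj u v ->
    edges_between (cover_list u) (cover_list v) = set0 }.

Definition fold_dp_cover (G : sgraph) (H : dp_cover G) (q : nat) : Prop :=
  forall v : G, #|cover_list H v| = q.

Definition dp_coloring (G : sgraph) (H : dp_cover G)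
    (f : {ffun G -> cover_graph H}) : bool :=
  [forall v : G, f v \in cover_list H v].

Definition proper_dp_colorings (G : sgraph) (H : dp_cover G) :
    {set {ffun G -> cover_graph H}} :=
  [set f | dp_coloring f && independent [set f v | v : G]].

(* Main.v *)
Require Import Defs.
From mathcomp Require Import all_boot all_order all_algebra.
From mathcomp Require Import reals sequences exp.
From mathcomp Require Import ring lra.
Import Order.TTheory GRing.Theory Num.Theory.
Local Open Scope ring_scope.

Set Implicit Arguments.
Unset Strict Implicit.
Unset Printing Implicit Defensive.

(** Proper partial colorings, in which a vertex may stay blank, are easier to
count than proper colorings.  Write N(U, S) for the number of those whose
colored vertices lie in U and include S.  The proof adds vertices one at a
time, first to U and then to S.

Adding an optional vertex v to U multiplies the count by one plus the average
number of colors available at v.  By triangle-freeness the neighbors of v are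
pairwise nonadjacent, so each of them may be recolored uniformly among its
current choices without changing the choices of the others
(sum_avail_resampled).  A color c at v thus survives with conditional
probability equal to the product, over the neighbors u of v in U, of 1 - k / M,
where M counts the choices of u and k <= 1 counts the available colors at u that
conflict with c.  When blank is a choice at u, with l colors
available, M = l + 1 and 1 - 1 / (l + 1) >= exp (- 1 / l); since at most l
colors of v are threatened by u, the exponents at u sum to at most 1 over the
q colors at v.  Convexity of exp then gives an average of at least
q exp (- d / q) >= q (1 - 1 / q)^d, where d is the number of neighbors of v in
U.  This is lossless, and so N(V, set0) >= q^n (1 - 1 / q)^m
(card_pcolorings_ge): the blanks remove the loss that (1 - 1 / l)^l < 1 / e
would cause for proper colorings.

It remains to require the vertices one by one, each at the cost of a factor
1 - delta.  The number of colorings with v blank is N(U, S) with U = V - v, and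
it suffices to bound it by delta times the number of those with v colored, that
is, to show that the average number of colors available at v is at least
1 / delta = q exp (- Delta / q) / 4 (card_pcolorings_le_sum_avail).  A required
neighbor u with l available colors now has M = l, which costs an additional
O(1 / l).  The sum of 1 / l over the colorings counted by N(U, S) is at most
N(U - u, S - u), which is at most delta N(U, S) by induction on U.  The total
loss is O((1 + Delta / q) Delta delta), at most 3 q / 4 when Delta is large, and
the factor 4 in delta absorbs it. *)

(** * Exponential estimates *)

Section Exp.
Variable R : realType.
Implicit Types a x t : R.

(** A tangent-line form of convexity: the left side is affine in the [t i], so
it can be summed over colors and over colorings.  The tangent is taken at
[\sum_i t i = a].  An index with [1 - x i = 0]
admits no exponential bound; it is harmless once [1 + a <= t i], because the
left side is then nonpositive. *)
Lemma prod_one_sub_ge (I : finType) (D : {pred I}) (x t : I -> R) a :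
  (forall i, i \in D -> [/\ x i <= 1, 0 <= t i
    & expR (- t i) <= 1 - x i \/ 1 + a <= t i]) ->
  expR (- a) * (1 + a - \sum_(i in D) t i) <= \prod_(i in D) (1 - x i).
Proof.
move=> Hxt.
case: (boolP [exists i in D, 1 + a <= t i]) => [/exists_inP[j jD tj]|].
  have sum_t : t j <= \sum_(i in D) t i.
    rewrite (bigD1 j) //= lerDl sumr_ge0 // => i /andP[iD _].
    by have [] := Hxt i iD.
  apply: (@le_trans _ _ 0).
    rewrite mulr_ge0_le0 ?expR_ge0 //; lra.
  apply: prodr_ge0 => i iD; have [xi _ _] := Hxt i iD; lra.
move=> /exists_inPn t_small.
apply: (@le_trans _ _ (\prod_(i in D) expR (- t i))).
  rewrite -expR_sum sumrN.
  rewrite [X in _ <= expR X](_ : _ = - a + (a - \sum_(i in D) t i));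
    last by ring.
  rewrite expRD ler_wpM2l ?expR_ge0 // -addrA.
  exact: expR_ge1Dx.
apply: ler_prod => i iD; rewrite expR_ge0 /=.
have [_ _ [//|big]] := Hxt i iD.
by have := t_small i iD; rewrite big.
Qed.

(** The bound for a neighbor with [l] available colors that may stay blank. *)
Lemma expRN_inv_le (l : nat) : (0 < l)%N ->
  expR (- l%:R^-1) <= 1 - (l.+1%:R)^-1 :> R.
Proof.
move=> l0; have l0' : 0 < l%:R :> R by rewrite ltr0n.
rewrite expRN -natr1.
have -> : 1 - (l%:R + 1)^-1 = (1 + l%:R^-1)^-1 :> R.
  by field; rewrite ?gt_eqF //; lra.
rewrite lef_pV2 ?posrE ?expR_gt0 ?expR_ge1Dx //.
by have := invr_gt0 (l%:R : R); lra.
Qed.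

(** The bound for a neighbor with [l] available colors that must be colored.
The correction [(2 + a) / l ^ 2] is dictated by two cases: at [l = 1] it has to
reach [1 + a], and for [l >= 2] it has to dominate
[1 / (l - 1) - 1 / l = 1 / (l * (l - 1))]. *)
Lemma expRN_inv_sq_le a (l : nat) : 0 <= a -> (0 < l)%N ->
  let t : R := l%:R^-1 + (2 + a) * l%:R^-1 ^+ 2 in
  expR (- t) <= 1 - l%:R^-1 \/ 1 + a <= t.
Proof.
move=> a0; case: l => [//|[|l]] _ t.
  by right; rewrite /t; clear t; rewrite invr1; lra.
left; apply: le_trans (@expRN_inv_le l.+1 _) => //.
rewrite ler_expR lerN2 /t; clear t.
have l0 : 0 < l.+1%:R :> R by rewrite ltr0n.
have l1 : 1 <= l.+1%:R :> R by rewrite ler1n.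
rewrite -[l.+2%:R]natr1; move: (l.+1%:R : R) l0 l1 => y l0 l1.
apply: (@le_trans _ _ ((y + 1)^-1 + 2 * (y + 1)^-1 ^+ 2)); last first.
  by rewrite lerD2l ler_wpM2r ?exprn_ge0 ?invr_ge0 //; lra.
have -> : (y + 1)^-1 + 2 * (y + 1)^-1 ^+ 2 =
    y^-1 + (y - 1) / (y * (y + 1) ^+ 2).
  by field; rewrite ?gt_eqF //; lra.
by rewrite lerDl mulr_ge0 ?invr_ge0 ?mulr_ge0 ?exprn_ge0 //; lra.
Qed.

Lemma cubic_le_expR (eps : R) : 0 < eps ->
  exists2 X : R, 0 <= X &
    forall x, X <= x -> 16 * (1 + x) ^+ 3 <= expR (eps * x).
Proof.
move=> e0; have e40 : 0 < eps ^+ 4 by rewrite exprn_gt0.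
have X0 : 0 <= 128 * 24 / eps ^+ 4 by rewrite divr_ge0 //; lra.
exists (1 + 128 * 24 / eps ^+ 4); first by rewrite addr_ge0.
move=> x Xx; have x1 : 1 <= x by apply: le_trans Xx; rewrite lerDl.
have ex : 128 * 24 <= eps ^+ 4 * x.
  by rewrite [leRHS]mulrC -ler_pdivrMr //; apply: le_trans Xx; rewrite lerDr.
have x3 : 0 <= x ^+ 3 / 24 by rewrite divr_ge0 // exprn_ge0; lra.
apply: (@le_trans _ _ (16 * (2 * x) ^+ 3)).
  by rewrite ler_wpM2l //; apply: lerXn2r; rewrite ?nnegrE; lra.
have ex0 : 0 <= eps * x by rewrite mulr_ge0; lra.
apply: le_trans (expR_ge1Dxn 3 ex0).
have -> : 16 * (2 * x) ^+ 3 = 128 * 24 * (x ^+ 3 / 24) by field.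
have -> : (eps * x) ^+ 4 / 4`!%:R = eps ^+ 4 * x * (x ^+ 3 / 24).
  by rewrite (_ : 4`! = 24)%N //; field.
have := ler_wpM2r x3 ex; lra.
Qed.

(** With [x = Delta / q], the lower bound on [q] says that
[expR ((1 + eps) * x) <= Delta], so the factor [expR (eps * x)] is spare.  It
absorbs any polynomial in [x] once [x] is large, and for bounded [x] the left
side is bounded. *)
Lemma fold_large (eps : R) : 0 < eps -> exists Delta0 : nat,
  forall Delta : nat, (Delta0 <= Delta)%N ->
  forall q : nat, (1 + eps) * Delta%:R / ln (Delta%:R : R) <= q%:R ->
  let x : R := Delta%:R / q%:R in
  (0 < q)%N /\ 16 * (1 + x) ^+ 3 * expR x <= Delta%:R.
Proof.
move=> e0; have [X X0 HX] := cubic_le_expR e0.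
exists (Num.bound (16 * (1 + X) ^+ 3 * expR X)).+2 => Delta Dbig q qbig x.
have D1 : 1 < Delta%:R :> R by rewrite ltr1n; exact: leq_trans Dbig.
have L0 : 0 < ln (Delta%:R : R) by rewrite ln_gt0.
have q0 : 0 < q%:R :> R.
  by apply: lt_le_trans qbig; rewrite divr_gt0 ?mulr_gt0 //; lra.
split; first by rewrite -(ltr0n R).
have x0 : 0 <= x by rewrite divr_ge0 //; lra.
have [xX|Xx] := ltP x X.
  apply: (@le_trans _ _ (16 * (1 + X) ^+ 3 * expR X)).
    apply: ler_pM; rewrite ?expR_ge0 ?mulr_ge0 ?exprn_ge0 ?ler_expR //; try lra.
    by rewrite ler_wpM2l //; apply: lerXn2r; rewrite ?nnegrE; lra.
  apply: (@le_trans _ _ (Num.bound (16 * (1 + X) ^+ 3 * expR X))%:R).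
    apply/ltW/archi_boundP.
    by rewrite mulr_ge0 ?expR_ge0 ?mulr_ge0 ?exprn_ge0; lra.
  by rewrite ler_nat; do 2 apply: ltnW.
apply: (@le_trans _ _ (expR (eps * x) * expR x)).
  by rewrite ler_wpM2r ?expR_ge0 // HX.
rewrite -expRD -[leRHS]lnK ?posrE; last by lra.
rewrite ler_expR; have -> : eps * x + x = (1 + eps) * Delta%:R / q%:R.
  by rewrite /x; field; rewrite gt_eqF.
by rewrite ler_pdivrMr // [leRHS]mulrC -ler_pdivrMr.
Qed.
End Exp.

(** * Partial colorings *)

Section PartialColorings.
Variables (G : sgraph) (H : dp_cover G).
Local Notation C := (cover_graph H).
Local Notation L := (cover_list H).
Local Notation pcoloring := {ffun G -> option C}.
Implicit Types (g h : pcoloring) (U S : {set G}) (u v w : G).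

Lemma cover_nonadj u v b c :
  ~~ adj u v -> b \in L u -> c \in L v -> ~~ adj b c.
Proof.
move=> nuv bu cv; have [euv|neq] := eqVneq u v.
  subst v; have /forall_inP/(_ b bu)/forall_inP/(_ c cv) //
    := cover_list_independent H u.
apply/negP => bc; have := cover_nonedge H neq nuv.
move/setP/(_ [set b; c]); rewrite inE => /negP; apply.
by apply/imset2P; exists b c; rewrite ?inE ?cv ?bc.
Qed.

Lemma cover_neighbors_le1 u v c :
  u != v -> c \in L v -> (#|[set b in L u | adj b c]| <= 1)%N.
Proof.
move=> neq cv; rewrite leqNgt; apply/negP => /card_gt1P[x [y [+ + xy]]].
rewrite !inE => /andP[xu xc] /andP[yu yc].
have /trivIsetP tr := cover_matching H neq.
have xcE : [set x; c] \in edges_between (L u) (L v).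
  by apply/imset2P; exists x c; rewrite ?inE ?cv ?xc.
have ycE : [set y; c] \in edges_between (L u) (L v).
  by apply/imset2P; exists y c; rewrite ?inE ?cv ?yc.
have nxy : [set x; c] != [set y; c].
  apply/negP => /eqP/setP/(_ x); rewrite !inE eqxx (negbTE xy) /=.
  by move=> /esym/eqP exc; move: xc; rewrite exc adj_irrefl.
have /pred0P/(_ c) := tr _ _ xcE ycE nxy.
by rewrite /= !inE eqxx !orbT.
Qed.

Definition conflict (c : C) (a : option C) : bool :=
  if a is Some b then adj b c else false.

(** The test against [g v] itself never fails when [g v] belongs to the list of
[v], which is independent; so [avail g v] does not change when [v] is
recolored. *)
Definition avail g v : {set C} :=
  [set c in L v | [forall w, ~~ conflict c (g w)]].

Definition list_choice v (a : option C) : bool :=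
  if a is Some c then c \in L v else true.

Definition list_valued g : bool := [forall v, list_choice v (g v)].

(** The colors used are required to be available, which says at once that they
come from the lists and that they are pairwise nonadjacent. *)
Definition pcolorings U S : {set pcoloring} :=
  [set g : pcoloring | [&&
    [forall v, if g v is Some c then c \in avail g v else true],
    [forall v, (g v != None) ==> (v \in U)] & [forall v in S, g v != None]]].

Definition upd g u (a : option C) : pcoloring :=
  [ffun w => if w == u then a else g w].

Lemma updE g u a w : upd g u a w = if w == u then a else g w.
Proof. by rewrite ffunE. Qed.

Lemma upd_same g u : upd g u (g u) = g.
Proof. by apply/ffunP => w; rewrite updE; case: eqP => [->|]. Qed.

Lemma upd_upd g u a b : upd (upd g u a) u b = upd g u b.
Proof. by apply/ffunP => w; rewrite !updE; case: eqP. Qed.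

Lemma availP g v c :
  reflect (c \in L v /\ forall w, ~~ conflict c (g w)) (c \in avail g v).
Proof. by rewrite inE; apply: (iffP andP) => -[-> /forallP]. Qed.

Lemma pcoloringsP U S g :
  reflect [/\ forall v c, g v = Some c -> c \in avail g v,
              forall v, v \notin U -> g v = None
            & forall v, v \in S -> g v <> None]
          (g \in pcolorings U S).
Proof.
rewrite inE; apply: (iffP and3P) => -[gP gU gS]; split.
- by move=> v c gv; have /forallP/(_ v) := gP; rewrite gv.
- move=> v vU; have /forallP/(_ v) := gU; rewrite (negbTE vU) implybF negbK.
  by move/eqP.
- by move=> v vS; have /forall_inP/(_ v vS)/eqP := gS.
- by apply/forallP => v; case gv: (g v) => [c|] //; apply: gP.
- apply/forallP => v; apply/implyP => gv; case: (boolP (v \in U)) => // vU.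
  by rewrite (gU v vU) eqxx in gv.
- by apply/forall_inP => v vS; apply/eqP/gS.
Qed.

Lemma pcolorings_list_valued U S g : g \in pcolorings U S -> list_valued g.
Proof.
case/pcoloringsP => gP _ _; apply/forallP => v; rewrite /list_choice.
by case gv: (g v) => [c|] //; have /availP[] := gP v c gv.
Qed.

Lemma conflict_nonadj u w c a :
  ~~ adj u w -> list_choice u a -> c \in L w -> ~~ conflict c a.
Proof. by case: a => //= b nuw bu cw; apply: cover_nonadj nuw bu cw. Qed.

(** Only the neighbors of [w] influence the colors available at [w].  The case
[w = u] is included: adjacency is irreflexive. *)
Lemma avail_upd g u a w : list_valued g -> list_choice u a -> ~~ adj u w ->
  avail (upd g u a) w = avail g w.
Proof.
move=> /forallP gL ua nuw; apply/setP => c; rewrite !inE.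
case cw: (c \in L w) => //=; apply: eq_forallb => z; rewrite updE.
case: eqP => [->|//].
by rewrite (conflict_nonadj nuw ua cw) (conflict_nonadj nuw (gL u) cw).
Qed.

Definition choices S h u (a : option C) : bool :=
  if a is Some c then c \in avail h u else u \notin S.

Lemma pcolorings_extend U S u g : u \notin U ->
  (g \in pcolorings (u |: U) S) =
  (upd g u None \in pcolorings U (S :\ u)) && choices S (upd g u None) u (g u).
Proof.
move=> uU; set h := upd g u None.
have hu : h u = None by rewrite updE eqxx.
have hE w : w != u -> h w = g w by move=> wu; rewrite updE (negbTE wu).
have sub v : avail g v \subset avail h v.
  apply/subsetP => c /availP[cv cg]; apply/availP; split=> // w.
  by rewrite updE; case: eqP.
apply/idP/andP => [/pcoloringsP[gP gU gS]|[/pcoloringsP[hP hU hS] ch]].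
  split.
    apply/pcoloringsP; split.
    - move=> v c; rewrite updE; case: eqP => // _ gv.
      by apply: (subsetP (sub v)); apply: gP.
    - move=> v vU; rewrite updE; case: eqP => // /eqP vu.
      by apply: gU; rewrite !inE negb_or vu.
    - by move=> v; rewrite !inE => /andP[vu vS]; rewrite hE //; apply: gS.
  rewrite /choices; case gu: (g u) => [c|].
    by apply: (subsetP (sub u)); apply: gP.
  by apply/negP => uS; case: (gS u uS).
apply/pcoloringsP; split.
- move=> v c gv; have [vu|vu] := eqVneq v u.
    subst v; move: ch; rewrite gv /= => /availP[cu ch].
    apply/availP; split=> // w; have [->|wu] := eqVneq w u.
      by rewrite gv /= adj_irrefl.
    by rewrite -hE.
  have /availP[cv ch'] : c \in avail h v by apply: hP; rewrite hE.
  apply/availP; split=> // w; have [->|wu] := eqVneq w u; last by rewrite -hE.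
  case gu: (g u) => [b|//] /=; move: ch; rewrite gu /= => /availP[_ /(_ v)].
  by rewrite hE // gv /= adj_sym.
- move=> v; rewrite !inE negb_or => /andP[vu vU].
  by rewrite -hE //; apply: hU.
- move=> v vS; have [vu|vu] := eqVneq v u; last first.
    by rewrite -hE //; apply: hS; rewrite !inE vu.
  by subst v => gu; move: ch; rewrite gu /= vS.
Qed.

(** Fubini for the vertex [u]: a partial coloring is a partial coloring of the
other vertices together with a choice at [u]. *)
Lemma sum_extend (V : nmodType) U S u (F : pcoloring -> V) :
  u \notin U ->
  \sum_(g in pcolorings (u |: U) S) F g =
  \sum_(h in pcolorings U (S :\ u))
    ((if u \in S then 0 else F h)
      + \sum_(c in avail h u) F (upd h u (Some c))).
Proof.
move=> uU.
have h_none h : h \in pcolorings U (S :\ u) -> upd h u None = h.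
  case/pcoloringsP => _ hU _; rewrite -[RHS](upd_same _ u); congr upd.
  by rewrite hU.
transitivity (\sum_(h in pcolorings U (S :\ u))
    \sum_(a | choices S h u a) F (upd h u a)).
  rewrite pair_big_dep /=.
  rewrite (reindex_onto (fun g => (upd g u None, g u))
                        (fun p => upd p.1 u p.2)) /=; last first.
    move=> [h a] /= /andP[hP _]; rewrite upd_upd h_none // updE eqxx //.
  apply: eq_big => [g|g _]; last by rewrite upd_upd upd_same.
  by rewrite upd_upd upd_same eqxx andbT pcolorings_extend.
apply: eq_bigr => h hP; rewrite big_mkcond (bigD1 None) //=.
rewrite if_neg h_none //; congr (_ + _).
rewrite (reindex_omap Some id) /=; last by case.
rewrite [RHS]big_mkcond /=.
by apply: eq_bigl => c; rewrite eqxx.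
Qed.
End PartialColorings.

(** * Resampling the neighbors of a vertex *)

Section Resampling.
Variables (R : realType) (G : sgraph) (H : dp_cover G).
Local Notation C := (cover_graph H).
Local Notation L := (cover_list H).
Local Notation pcoloring := {ffun G -> option C}.
Local Notation P := (pcolorings H).
Implicit Types (g h : pcoloring) (U S : {set G}) (u v w : G).

Definition nchoices S g u : nat := (#|avail g u| + (u \notin S))%N.

(** The conditional probability, given [g] outside [u], that a uniform choice at
[u] conflicts with [c]. *)
Definition hit_prob S g u (c : C) : R :=
  #|[set b in avail g u | adj b c]|%:R / (nchoices S g u)%:R.

Definition insensitive (F : pcoloring -> R) u : Prop :=
  forall g a, list_valued g -> list_choice u a -> F (upd g u a) = F g.

Lemma hit_prob_insensitive S u w c : ~~ adj u w ->
  insensitive (fun g => hit_prob S g w c) u.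
Proof.
move=> nuw g a gL ua.
by rewrite /hit_prob /nchoices avail_upd.
Qed.

(** Taking the conditional expectation over the choice at [u]. *)
Lemma resample1 U S u c (F : pcoloring -> R) : u \in U -> insensitive F u ->
  \sum_(g in P U S) F g * (1 - (conflict c (g u))%:R) =
  \sum_(g in P U S) F g * (1 - hit_prob S g u c).
Proof.
move=> uU insF; rewrite -(setD1K uU).
have uU' : u \notin U :\ u by rewrite !inE eqxx.
rewrite !sum_extend //; apply: eq_bigr => h hP.
have hL := pcolorings_list_valued hP.
have hu : h u = None by have /pcoloringsP[_ ->] := hP.
have updF b : b \in avail h u -> F (upd h u (Some b)) = F h.
  by move=> /availP[bu _]; apply: insF.
have updX b : b \in avail h u ->
    hit_prob S (upd h u (Some b)) u c = hit_prob S h u c.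
  by move=> /availP[bu _]; apply: hit_prob_insensitive; rewrite ?adj_irrefl.
under eq_bigr => b bA do rewrite updF // updE eqxx /=.
under [in RHS]eq_bigr => b bA do rewrite updF // updX //.
rewrite hu /= subr0 mulr1 -mulr_sumr sumr_const.
rewrite sumrB -natr_sum sumr_const.
have -> : (\sum_(b in avail h u) adj b c = #|[set b in avail h u | adj b c]|)%N.
  by rewrite -sum1dep_card big_mkcondr /=; apply: eq_bigr => b _; case: adj.
rewrite /hit_prob /nchoices; set k := #|[set b in _ | _]|.
set l := #|avail h u|; have kl : (k <= l)%N.
  by apply/subset_leq_card/subsetP => b; rewrite inE => /andP[].
move: (F h) => X.
case uS: (u \in S) => /=.
  rewrite addn0 !add0r -[RHS]mulr_natr -mulrA; congr (_ * _).
  case l0 : l kl => [|l'].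
    by rewrite leqn0 => /eqP ->; rewrite mulr0 subr0.
  by move=> _; rewrite mulrBl mul1r divfK ?pnatr_eq0.
rewrite -[X in _ = _ + X]mulr_natr addn1; set t : R := k%:R / l.+1%:R.
have -> : k%:R = t * (l%:R + 1) by rewrite natr1 divfK ?pnatr_eq0.
ring.
Qed.

(** The weight [F] is there for the induction on [s]: while the tail of [s] is
resampled it absorbs the factor of the head [u], which depends on the color of
[u] only.  When [u] is resampled in turn, the factors [1 - hit_prob] of the tail
belong to the weight; they ignore the color of [u] because the vertices of [s]
are pairwise nonadjacent. *)
Lemma resample U S c (s : seq G) (F : pcoloring -> R) :
  uniq s -> {subset s <= U} -> {in s &, forall u w, ~~ adj u w} ->
  {in s, forall u, insensitive F u} ->
  \sum_(g in P U S) F g * \prod_(u <- s) (1 - (conflict c (g u))%:R) =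
  \sum_(g in P U S) F g * \prod_(u <- s) (1 - hit_prob S g u c).
Proof.
elim: s F => [|u s IH] F /=; first by under eq_bigr do rewrite !big_nil;
  under [in RHS]eq_bigr do rewrite !big_nil.
move=> /andP[us uniq_s] sU ind insF.
have sub_s w : w \in s -> w \in u :: s by move=> ws; rewrite inE ws orbT.
have u_in : u \in u :: s by rewrite mem_head.
under eq_bigr do rewrite big_cons mulrA.
under [in RHS]eq_bigr do rewrite big_cons mulrA mulrAC.
rewrite IH //; first last.
- move=> w ws g a gL wa; rewrite (insF w (sub_s w ws)) // updE.
  by case: eqP => // uw; rewrite uw ws in us.
- by move=> w z ws zs; apply: ind; apply: sub_s.
- by move=> w ws; apply: sU; apply: sub_s.
under [LHS]eq_bigr do rewrite mulrAC.
apply: (@resample1 U S u c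
  (fun g => F g * \prod_(w <- s) (1 - hit_prob S g w c))); first exact: sU.
move=> g a gL ua; rewrite (insF u u_in) //; congr (_ * _).
apply: eq_big_seq => w ws; congr (1 - _).
by apply: hit_prob_insensitive => //; apply: ind => //; apply: sub_s.
Qed.

Definition nbrs_in U v : {set G} := [set u in U | adj v u].

Lemma avail_indicator U S v c g : g \in P U S -> c \in L v ->
  (c \in avail g v)%:R =
  \prod_(u <- enum (nbrs_in U v)) (1 - (conflict c (g u))%:R) :> R.
Proof.
move=> gP cv; rewrite big_enum /=.
have gL := pcolorings_list_valued gP.
case: (boolP (c \in avail g v)) => [/availP[_ cg]|].
  by rewrite big1 // => u _; rewrite (negbTE (cg u)) subr0.
rewrite inE cv /= => /forallPn[w]; rewrite negbK => cw.
rewrite (bigD1 w) /= ?cw ?subrr ?mul0r //.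
rewrite inE; apply/andP; split.
  apply/negPn/negP => wU; have /pcoloringsP[_ gU _] := gP.
  by move: cw; rewrite gU.
rewrite adj_sym; apply/negPn/negP => nwv.
by move: cw; rewrite (negbTE (conflict_nonadj nwv (forallP gL w) cv)).
Qed.

(** Triangle-freeness makes the neighbors of [v] pairwise nonadjacent, so they
can all be resampled. *)
Lemma sum_avail_resampled U S v : triangle_free G ->
  \sum_(g in P U S) #|avail g v|%:R =
  \sum_(g in P U S) \sum_(c in L v)
     \prod_(u in nbrs_in U v) (1 - hit_prob S g u c).
Proof.
move=> tf.
transitivity (\sum_(g in P U S) \sum_(c in L v) (c \in avail g v)%:R : R).
  apply: eq_bigr => g gP; rewrite -natr_sum; congr (_%:R).
  rewrite -sum1_card big_mkcond [RHS]big_mkcond /=; apply: eq_bigr => c _.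
  by rewrite inE; case: (c \in L v).
rewrite exchange_big [RHS]exchange_big /=; apply: eq_bigr => c cv.
rewrite (eq_bigr (fun g => 1 *
    \prod_(u <- enum (nbrs_in U v)) (1 - (conflict c (g u))%:R))); last first.
  by move=> g gP; rewrite mul1r (avail_indicator gP cv).
rewrite (@resample U S c _ (fun=> 1)) //; first by
  apply: eq_bigr => g _; rewrite mul1r big_enum.
- exact: enum_uniq.
- by move=> u; rewrite mem_enum inE => /andP[].
- move=> u w; rewrite !mem_enum !inE => /andP[_ vu] /andP[_ vw].
  by apply/negP => uw; apply: (tf v u w); split.
Qed.

(** The loss caused by a neighbor that is required to be colored.  The value is
[0] when no color is available, as [0^-1 = 0]. *)
Definition req_loss S g u : R := if u \in S then #|avail g u|%:R^-1 else 0.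

(** The exponent attached to [u] and [c] is [k u c * wt u], where [k u c] is [0]
or [1] since the cover restricts to a matching between two lists.  The matching
also bounds the sum of [k u c] over [c] by the number of colors available at
[u], so the exponents at [u] add up to at most
[1 + (2 + a) * req_loss S g u]. *)
Lemma sum_prod_ge U S v g (q : nat) a : (0 < q)%N -> fold_dp_cover H q ->
  g \in P U S ->
  a = #|nbrs_in U v|%:R / q%:R ->
  expR (- a) * (q%:R - (2 + a) * \sum_(u in nbrs_in U v) req_loss S g u) <=
  \sum_(c in L v) \prod_(u in nbrs_in U v) (1 - hit_prob S g u c).
Proof.
move=> q0 fold gP; set D := nbrs_in U v => aE.
have a0 : 0 <= a by rewrite aE divr_ge0.
have q0' : 0 < q%:R :> R by rewrite ltr0n.
pose wt u : R := #|avail g u|%:R^-1 + (2 + a) * (req_loss S g u) ^+ 2.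
pose k u c := #|[set b in avail g u | adj b c]|.
have loss0 u : 0 <= req_loss S g u.
  by rewrite /req_loss; case: ifP => // _; rewrite invr_ge0.
have wt0 u : 0 <= wt u.
  by rewrite addr_ge0 ?invr_ge0 // mulr_ge0 ?exprn_ge0 //; lra.
have Dneq u : u \in D -> u != v.
  by rewrite inE => /andP[_]; apply: contraTneq => ->; rewrite adj_irrefl.
apply: (@le_trans _ _ (\sum_(c in L v)
    expR (- a) * (1 + a - \sum_(u in D) (k u c)%:R * wt u))); last first.
  apply: ler_sum => c cv; apply: prod_one_sub_ge => u uD.
  have k1 : (k u c <= 1)%N.
    apply: leq_trans (cover_neighbors_le1 (Dneq u uD) cv).
    apply/subset_leq_card/subsetP => b; rewrite !inE => /andP[/andP[-> _]].
    by move->.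
  split; rewrite /hit_prob -/(k u c).
  - rewrite /nchoices -/(k u c); case: (k u c) k1 => [|[|//]] _.
      by rewrite mul0r.
    rewrite mul1r; case: (_ + _)%N => [|l]; first by rewrite invr0.
    by rewrite invf_le1 ?ler1n ?ltr0n.
  - by rewrite mulr_ge0.
  (* If k u c = 1, some color is available at u: the bounds for l > 0 apply. *)
  have : (k u c <= #|avail g u|)%N.
    by apply/subset_leq_card/subsetP => b; rewrite inE => /andP[].
  rewrite /nchoices /wt /req_loss.
  case: (k u c) k1 => [|[|//]] _.
    by left; rewrite !mul0r oppr0 expR0 addr0.
  move=> l0; rewrite !mul1r; case uS: (u \in S) => /=.
    by rewrite addn0; apply: expRN_inv_sq_le.
  by left; rewrite expr0n /= mulr0 addr0 addn1; apply: expRN_inv_le.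
rewrite -mulr_sumr ler_wpM2l ?expR_ge0 // sumrB exchange_big /=.
have -> : \sum_(c in L v) (1 + a) = q%:R + #|D|%:R.
  by rewrite sumr_const fold -[LHS]mulr_natr mulrDl mul1r aE divfK ?gt_eqF.
have sumk u : u \in D -> \sum_(c in L v) (k u c)%:R * wt u <=
    1 + (2 + a) * req_loss S g u.
  move=> uD; rewrite -mulr_suml -natr_sum.
  have kl : (\sum_(c in L v) k u c <= #|avail g u|)%N.
    have -> : (\sum_(c in L v) k u c =
        \sum_(b in avail g u) #|[set c in L v | adj c b]|)%N.
      transitivity (\sum_(c in L v) \sum_(b in avail g u) adj b c)%N.
        apply: eq_bigr => c _; rewrite /k -sum1dep_card big_mkcondr /=.
        by apply: eq_bigr => b _; case: adj.
      rewrite exchange_big /=; apply: eq_bigr => b _.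
      rewrite -sum1dep_card big_mkcondr /=.
      by apply: eq_bigr => c _; rewrite adj_sym; case: adj.
    rewrite -sum1_card; apply: leq_sum => b /availP[bu _].
    by apply: cover_neighbors_le1 bu; rewrite eq_sym Dneq.
  apply: (@le_trans _ _ (#|avail g u|%:R * wt u)).
    by rewrite ler_wpM2r // ler_nat.
  rewrite /wt /req_loss.
  case: (#|avail g u|) => [|l].
    rewrite mul0r; case: (u \in S); rewrite ?invr0 ?mulr0; lra.
  have : (l.+1%:R : R) != 0 by rewrite pnatr_eq0.
  move: (l.+1%:R : R) => y y0.
  by case: (u \in S); rewrite le_eqVlt; apply/orP; left; apply/eqP; field.
suff : \sum_(u in D) \sum_(c in L v) (k u c)%:R * wt u <=
    #|D|%:R + (2 + a) * \sum_(u in D) req_loss S g u by lra.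
apply: le_trans (ler_sum _ sumk) _.
by rewrite big_split /= sumr_const -mulr_sumr.
Qed.
End Resampling.

(** * Counting partial colorings *)

Lemma finset_ind (T : finType) (P : {set T} -> Prop) :
  P set0 -> (forall x (A : {set T}), x \notin A -> P A -> P (x |: A)) ->
  forall A, P A.
Proof.
move=> P0 PU A; have [n] := ubnP #|A|; elim: n A => // n IH A cardA.
have [->|[x xA]] := set_0Vmem A => //.
rewrite -(setD1K xA); apply: PU; first by rewrite setD11.
by apply: IH; rewrite (cardsD1 x A) xA in cardA.
Qed.

Section Counting.
Variables (R : realType) (G : sgraph) (H : dp_cover G).
Local Notation C := (cover_graph H).
Local Notation L := (cover_list H).
Local Notation pcoloring := {ffun G -> option C}.
Local Notation P := (pcolorings H).
Local Notation N U S := (#|P U S|%:R : R).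
Implicit Types (g h : pcoloring) (U S : {set G}) (u v w : G).

Lemma card_pcolorings_extend U S v : v \notin U -> v \notin S ->
  N (v |: U) S = N U S + \sum_(h in P U S) #|avail h v|%:R.
Proof.
move=> vU vS; rewrite -sum1_card natr_sum sum_extend // (negbTE vS).
have -> : S :\ v = S.
  by apply/setDidPl; rewrite disjoint_sym disjoints1.
rewrite big_split /= sumr_const; congr (_ + _).
by apply: eq_bigr => h _; rewrite sumr_const.
Qed.

Lemma card_pcolorings_require U S v : v \notin U -> v \notin S ->
  N (v |: U) (v |: S) = \sum_(h in P U S) #|avail h v|%:R.
Proof.
move=> vU vS; rewrite -sum1_card natr_sum sum_extend // setU11 setU1K //.
by apply: eq_bigr => h _; rewrite add0r sumr_const.
Qed.

(** The number of available colors cancels: each coloring outside [u] with at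
least one color available at [u] contributes exactly [1]. *)
Lemma sum_req_loss_le U S u : u \in U ->
  \sum_(g in P U S) req_loss R S g u <=
  if u \in S then N (U :\ u) (S :\ u) else 0.
Proof.
move=> uU; rewrite /req_loss; case: ifP => uS; last by rewrite big1.
rewrite -{1}(setD1K uU) sum_extend ?setD11 // uS.
rewrite -sum1_card natr_sum; apply: ler_sum => h hP; rewrite add0r.
have hL := pcolorings_list_valued hP.
rewrite (eq_bigr (fun=> #|avail h u|%:R^-1)); last first.
  by move=> c /availP[cu _]; rewrite avail_upd ?adj_irrefl.
rewrite sumr_const -[leLHS]mulr_natr.
have [->|l0] := posnP #|avail h u|; first by rewrite mulr0.
by rewrite mulVf // pnatr_eq0 -lt0n.
Qed.

Lemma sum_avail_ge U S v q a : triangle_free G -> (0 < q)%N ->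
  fold_dp_cover H q -> a = #|nbrs_in U v|%:R / q%:R ->
  expR (- a) * (q%:R * N U S
    - (2 + a) * \sum_(u in nbrs_in U v | u \in S) N (U :\ u) (S :\ u)) <=
  \sum_(g in P U S) #|avail g v|%:R.
Proof.
move=> tf q0 fold aE; rewrite sum_avail_resampled //.
have a0 : 0 <= a by rewrite aE divr_ge0.
apply: (@le_trans _ _ (\sum_(g in P U S) expR (- a) *
    (q%:R - (2 + a) * \sum_(u in nbrs_in U v) req_loss R S g u))); last first.
  by apply: ler_sum => g gP; apply: sum_prod_ge aE.
rewrite -mulr_sumr ler_wpM2l ?expR_ge0 // sumrB sumr_const -mulr_sumr.
rewrite mulr_natr lerD2l lerN2 ler_wpM2l //; first by lra.
rewrite exchange_big big_mkcondr /=; apply: ler_sum => u.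
by rewrite inE => /andP[uU _]; apply: sum_req_loss_le.
Qed.

Lemma card_nbrs_in_le U v Delta : (max_degree G <= Delta)%N ->
  (#|nbrs_in U v| <= Delta)%N.
Proof.
apply: leq_trans; apply: leq_trans (leq_bigmax v).
by apply/subset_leq_card/subsetP => u; rewrite !inE => /andP[].
Qed.

(** A vertex left optional is blank in at most a proportion [delta] of the
colorings.  The induction hypothesis is applied to the required neighbors [u] of
[v], in the graph without [u]: it bounds the average of the inverse number of
colors available at [u], which is the loss in [sum_avail_ge]. *)
Lemma card_pcolorings_le_sum_avail (q Delta : nat) (delta : R) :
  triangle_free G -> (max_degree G <= Delta)%N -> (0 < q)%N ->
  fold_dp_cover H q ->
  let x : R := Delta%:R / q%:R in
  delta = 4 * expR x / q%:R ->
  (2 + x) * Delta%:R * delta <= 3 / 4 * q%:R ->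
  forall U S v, v \notin U -> S \subset U ->
  N U S <= delta * \sum_(h in P U S) #|avail h v|%:R.
Proof.
move=> tf degG q0 fold x deltaE small U.
have q0' : 0 < q%:R :> R by rewrite ltr0n.
have delta0 : 0 < delta by rewrite deltaE divr_gt0 ?mulr_gt0 ?expR_gt0.
have [n] := ubnP #|U|; elim: n U => // n IH U cardU S v vU SU.
have dD := card_nbrs_in_le U v degG.
set D := nbrs_in U v in dD.
pose a : R := #|D|%:R / q%:R.
have a0 : 0 <= a by rewrite divr_ge0.
have ax : a <= x by rewrite ler_wpM2r ?invr_ge0 ?ler_nat.
have N0 : 0 <= N U S by [].
have loss : \sum_(u in D | u \in S) N (U :\ u) (S :\ u) <=
    Delta%:R * (delta * N U S).
  apply: (@le_trans _ _ (\sum_(u in D) delta * N U S)); last first.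
    rewrite sumr_const -[leLHS]mulr_natl ler_wpM2r ?ler_nat //.
    by rewrite mulr_ge0 // ltW.
  rewrite big_mkcondr; apply: ler_sum => u; rewrite inE => /andP[uU _].
  case: ifP => uS; last by rewrite mulr_ge0 // ltW.
  rewrite -[in leRHS](setD1K uU) -[in leRHS](setD1K uS).
  rewrite card_pcolorings_require ?setD11 //; apply: IH; rewrite ?setD11 //.
    by rewrite (cardsD1 u U) uU in cardU.
  exact: setSD.
have := @sum_avail_ge U S v q a tf q0 fold erefl; rewrite -/D.
set A := \sum_(g in P U S) _ => geA.
have small_loss : q%:R / 4 * N U S <=
    q%:R * N U S - (2 + a) * \sum_(u in D | u \in S) N (U :\ u) (S :\ u).
  have : (2 + a) * \sum_(u in D | u \in S) N (U :\ u) (S :\ u) <=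
      (2 + x) * (Delta%:R * (delta * N U S)).
    by apply: ler_pM => //; [lra|exact: sumr_ge0|lra].
  by have := ler_wpM2r N0 small; lra.
have : expR (- x) * (q%:R / 4 * N U S) <= A.
  apply: le_trans geA; apply: ler_pM => //.
  - exact: expR_ge0.
  - by rewrite mulr_ge0 ?divr_ge0.
  - by rewrite ler_expR lerN2.
move/(ler_wpM2l (ltW delta0)); apply: le_trans.
rewrite le_eqVlt; apply/orP; left; apply/eqP.
rewrite deltaE expRN; field.
by rewrite (gt_eqF q0') (gt_eqF (expR_gt0 x)).
Qed.

Lemma card_pcolorings_require_all (delta : R) : 0 <= delta <= 1 ->
  (forall U S v, v \notin U -> S \subset U ->
     N U S <= delta * \sum_(h in P U S) #|avail h v|%:R) ->
  (1 - delta) ^+ #|G| * N [set: G] set0 <= N [set: G] [set: G].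
Proof.
move=> /andP[delta0 delta1] rare.
suff H1 S : (1 - delta) ^+ #|S| * N [set: G] set0 <= N [set: G] S.
  by have := H1 [set: G]; rewrite cardsT.
elim/finset_ind: S => [|v S vS IH]; first by rewrite cards0 mul1r.
have vT := setD1K (in_setT v); set T := [set: G] :\ v in vT.
have vT' : v \notin T by rewrite setD11.
have ST : S \subset T by rewrite subsetD1 subsetT.
rewrite cardsU1 vS add1n exprS -mulrA.
apply: (@le_trans _ _ ((1 - delta) * N [set: G] S)).
  by rewrite ler_wpM2l // subr_ge0.
rewrite -vT card_pcolorings_require // card_pcolorings_extend //.
have := rare T S v vT' ST; set A := \sum_(h in _) _ => NA.
have A0 : 0 <= A by apply: sumr_ge0.
have := mulr_ge0 delta0 (ler0n R #|P T S|); lra.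
Qed.

Lemma card_edges_extend U v : v \notin U ->
  (#|edges_between U U| + #|nbrs_in U v| <=
   #|edges_between (v |: U) (v |: U)|)%N.
Proof.
move=> vU; have inj : {in nbrs_in U v &, injective (fun u => [set u; v])}.
  move=> u w; rewrite !inE => /andP[uU _] /andP[wU _] /setP/(_ u).
  rewrite !inE eqxx /= => /esym/orP[/eqP//|/eqP uv].
  by rewrite -uv uU in vU.
rewrite -(card_in_imset inj) -cardsUI.
have -> : edges_between U U :&: [set [set u; v] | u in nbrs_in U v] = set0.
  apply/setP => e; rewrite !inE; apply/negP => /andP[].
  move=> /imset2P[x y xU]; rewrite inE => /andP[yU _] -> /imsetP[u _].
  move/setP/(_ v); rewrite !inE eqxx orbT => /orP[]/eqP vE.
    by rewrite vE xU in vU.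
  by rewrite vE yU in vU.
rewrite cards0 addn0; apply/subset_leq_card/subsetP => e; rewrite inE.
case/orP => [/imset2P[x y xU]|/imsetP[u]].
  rewrite inE => /andP[yU xy] ->; apply/imset2P; exists x y => //.
    by rewrite !inE xU orbT.
  by rewrite !inE yU orbT.
rewrite inE => /andP[uU vu] ->; apply/imset2P; exists u v => //.
  by rewrite !inE uU orbT.
by rewrite !inE eqxx adj_sym.
Qed.

Lemma card_pcolorings_ge (q : nat) U : triangle_free G -> (0 < q)%N ->
  fold_dp_cover H q ->
  (1 - 1 / q%:R) ^+ #|edges_between U U| * q%:R ^+ #|U| <= N U set0.
Proof.
move=> tf q0 fold.
have q0' : 0 < q%:R :> R by rewrite ltr0n.
have base0 : 0 <= 1 - 1 / q%:R :> R.
  by rewrite subr_ge0 mul1r invf_le1 // ler1n.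
have base1 : 1 - 1 / q%:R <= 1 :> R by rewrite gerBl divr_ge0.
elim/finset_ind: U => [|v U vU IH].
  have -> : edges_between set0 set0 = set0 :> {set {set G}}.
    apply/setP => e; rewrite inE; apply/imset2P => -[x y].
    by rewrite in_set0.
  rewrite !cards0 mulr1 ler1n card_gt0; apply/set0Pn; exists [ffun=> None].
  by apply/pcoloringsP; split=> [w c|w _|w]; rewrite ?ffunE ?inE.
set a : R := #|nbrs_in U v|%:R / q%:R.
have pow_le : (1 - 1 / q%:R) ^+ #|nbrs_in U v| <= expR (- a).
  have -> : - a = #|nbrs_in U v|%:R * - (1 / q%:R) by rewrite /a; ring.
  rewrite expRM_natl; apply: lerXn2r; rewrite ?nnegrE ?expR_ge0 //.
  exact: expR_ge1Dx.
have := @sum_avail_ge U set0 v q a tf q0 fold erefl.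
rewrite big_pred0; last by move=> u; rewrite in_set0 andbF.
rewrite mulr0 subr0 => geA.
rewrite card_pcolorings_extend ?inE //.
apply: le_trans (_ : _ <= \sum_(h in P U set0) #|avail h v|%:R) _; last first.
  by rewrite lerDr.
apply: le_trans geA; rewrite cardsU1 vU add1n exprS.
apply: (@le_trans _ _ (expR (- a) * (q%:R *
    ((1 - 1 / q%:R) ^+ #|edges_between U U| * q%:R ^+ #|U|)))); last first.
  by rewrite ler_wpM2l ?expR_ge0 // ler_wpM2l.
rewrite [leRHS]mulrCA [leRHS]mulrA [leLHS]mulrCA -[leRHS]mulrA.
rewrite ler_wpM2l // [leRHS]mulrA ler_wpM2r ?exprn_ge0 //.
apply: (@le_trans _ _ ((1 - 1 / q%:R) ^+
    (#|edges_between U U| + #|nbrs_in U v|))).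
  by apply: ler_wiXn2l => //; exact: card_edges_extend.
by rewrite exprD mulrC ler_wpM2r ?exprn_ge0.
Qed.

Lemma card_pcolorings_total_le :
  (#|P [set: G] [set: G]| <= #|proper_dp_colorings H|)%N.
Proof.
pose emb (f : {ffun G -> C}) : pcoloring := [ffun v => Some (f v)].
apply: leq_trans (leq_imset_card emb _).
apply/subset_leq_card/subsetP => g /pcoloringsP[gP _ gT].
have ex v : exists c, g v = Some c.
  by case gv: (g v) (gT v (in_setT v)) => [c|//] _; exists c.
have [f fE] := fin_all_exists ex.
have fP v : f v \in avail g v by apply: gP.
apply/imsetP; exists [ffun v => f v]; last first.
  by apply/ffunP => v; rewrite !ffunE fE.
rewrite inE; apply/andP; split.
  by apply/forallP => v; rewrite ffunE; have /availP[] := fP v.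
apply/forall_inP => x /imsetP[u _ ->]; apply/forall_inP => y /imsetP[v _ ->].
rewrite !ffunE; have /availP[_ /(_ u)] := fP v.
by rewrite fE.
Qed.
End Counting.

(** * The lower bound *)

Theorem theorem1p8 (R : realType) (eps : R) (eps_gt0 : 0 < eps) :
  exists Delta0 : nat,
  forall Delta : nat, (Delta0 <= Delta)%N ->
  forall G : sgraph, triangle_free G -> (max_degree G <= Delta)%N ->
  forall q : nat, (1 + eps) * Delta%:R / ln (Delta%:R : R) <= q%:R ->
  forall H : dp_cover G, fold_dp_cover H q ->
  let n := #|G| in
  let m := #|edges G| in
  let delta : R := 4 * expR (Delta%:R / q%:R) / q%:R in
  (1 - 1 / q%:R) ^+ m * ((1 - delta) * q%:R) ^+ n
    <= #|proper_dp_colorings H|%:R.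
Proof.
have [Delta0 large] := fold_large eps_gt0.
exists Delta0 => Delta DeltaP G tf degG q qP H fold /=.
set delta : R := 4 * expR _ / _.
have [q0 big] := large Delta DeltaP q qP.
have q0' : 0 < q%:R :> R by rewrite ltr0n.
pose x : R := Delta%:R / q%:R; rewrite -/x in big.
have x0 : 0 <= x by rewrite divr_ge0.
have ex0 : 0 < expR x by apply: expR_gt0.
have DE : Delta%:R = x * q%:R by rewrite divfK ?gt_eqF.
have x_gt0 : 0 < x.
  rewrite lt0r x0 andbT; apply/eqP => xE; move: big.
  rewrite DE xE mul0r expR0; lra.
(* Multiplying through by x > 0 turns q into Delta, which fold_large bounds. *)
have pointwise (c : R) : x * c <= 16 * (1 + x) ^+ 3 -> c * expR x <= q%:R.
  move=> cx; rewrite -(ler_pM2l x_gt0) -DE mulrA.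
  by apply: le_trans big; rewrite ler_wpM2r // ltW.
have x2 := exprn_ge0 2 x0; have x3 := exprn_ge0 3 x0.
have delta01 : 0 <= delta <= 1.
  apply/andP; split; first by rewrite divr_ge0 ?mulr_ge0 ?expR_ge0.
  rewrite /delta -/x ler_pdivrMr // mul1r; apply: pointwise; lra.
have small : (2 + x) * Delta%:R * delta <= 3 / 4 * q%:R.
  have -> : (2 + x) * Delta%:R * delta =
      3 / 4 * (16 / 3 * x * (2 + x) * expR x).
    by rewrite /delta -/x DE; field; rewrite gt_eqF.
  have : 16 / 3 * x * (2 + x) * expR x <= q%:R by apply: pointwise; lra.
  lra.
have rare := @card_pcolorings_le_sum_avail R G H q Delta delta tf degG q0 fold
  erefl small.
apply: (@le_trans _ _ #|pcolorings H [set: G] [set: G]|%:R); last first.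
  by rewrite ler_nat card_pcolorings_total_le.
apply: le_trans (card_pcolorings_require_all delta01 rare).
rewrite exprMn mulrCA ler_wpM2l //.
  by apply: exprn_ge0; case/andP: delta01; lra.
by have := @card_pcolorings_ge R G H q [set: G] tf q0 fold; rewrite cardsT.
Qed.
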